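(* Let $\mathbb F$ be an infinite field with $\operatorname{char}\mathbb F\neq2$ and let $d\ge1$. If $\operatorname{char}\mathbb F>0$, then the ideal of free relations $\bigcap_{i>0}K_i$ lies in the ideal of $\mathcal N_\sigma$ generated by the elements $\sigma_t(\alpha)^{\operatorname{char}\mathbb F}$, where $\alpha$ ranges over $\mathcal N$ and $t>0$. If $\operatorname{char}\mathbb F=0$, then the only free relation is trivial, i.e. $\bigcap_{i>0}K_i=0$.
   Context: For $n\ge1$ let $R_n=\mathbb F[x_{ij}(k)\mid 1\le i,j\le n,\ 1\le k\le d]$, with generic $n\times n$ matrices $X_k=(x_{ij}(k))_{i,j}$, $1\le k\le d$. For an $n\times n$ matrix $A$, $\sigma_t(A)$ is defined by $\det(A+\lambda E)=\sum_{t=0}^n\lambda^{n-t}\sigma_t(A)$. $R^{O(n)}$ is the subalgebra of $R_n$ generated by all $\sigma_t(A)$, $1\le t\le n$, $A$ a monomial in $X_1,\dots,X_d,X_1^T,\dots,X_d^T$. $\mathcal M$ is the free monoid without unity on the letters $1,\dots,d,1^T,\dots,d^T$, with involution $i\leftrightarrow i^T$, $(\alpha_1\cdots\alpha_p)^T=\alpha_p^T\cdots\alpha_1^T$. A word is primitive if it is not a power of a shorter word; $\mathcal N\subset\mathcal M$ is the set of primitive words. $\alpha\sim\beta$ means that some cyclic permutation of $\alpha$ equals $\beta$ or $\beta^T$. $\mathcal N_\sigma$ is the commutative unital polynomial ring over $\mathbb F$ freely generated by symbols $\sigma_t(\alpha)$, $t>0$, where $\alpha\in\mathcal N$ ranges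 over $\sim$-classes. Put $X_{i}$ for the letter $i$, $X_i^T$ for the letter $i^T$, and $X_\alpha=X_{\alpha_1}\cdots X_{\alpha_p}$ for $\alpha=\alpha_1\cdots\alpha_p\in\mathcal M$. $\Psi_n:\mathcal N_\sigma\to R^{O(n)}$ is the surjective algebra homomorphism with $\sigma_t(\alpha)\mapsto\sigma_t(X_\alpha)$ if $t\le n$ and $\sigma_t(\alpha)\mapsto0$ if $t>n$; $K_n=\ker\Psi_n$. Elements of $\bigcap_{i>0}K_i$ are called free relations. *)

(* Defs.v *)
From HB Require Import structures.
From mathcomp Require Import all_boot all_order all_algebra.
From mathcomp Require Import generic_quotient finmap.
From mathcomp.multinomials Require Import monalg.

Set Implicit Arguments.
Unset Strict Implicit.
Unset Printing Implicit Defensive.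

Import GRing.Theory.

Local Open Scope quotient_scope.
Local Open Scope ring_scope.

(* {malg R[{cmonom I}]} is the polynomial ring over R in the variables I, for
   an arbitrary (possibly infinite) choiceType I. *)

Definition pvar (R : comNzRingType) (I : choiceType) (i : I) :
  {malg R[{cmonom I}]} := << ucm i >>.

Section MonomEval.
Context (I : choiceType) (S : comNzRingType) (v : I -> S).

Definition cmeval (m : {cmonom I}) : S := \prod_(i <- finsupp m) v i ^+ m i.

Lemma cmeval_widen (D : {fset I}) (m : {cmonom I}) :
  (finsupp m `<=` D)%fset -> cmeval m = \prod_(i <- D) v i ^+ m i.
Proof.
move=> le; rewrite /cmeval [LHS](big_fset_incl _ le) //= => i _.
by rewrite -cmE_eq0 => /eqP ->.
Qed.

Lemma cmeval_mmorphism : mmorphism cmeval.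
Proof.
split=> [m1 m2|]; last by rewrite /cmeval mdom1 big_seq_fset0.
rewrite (@cmeval_widen (finsupp m1 `|` finsupp m2)%fset m1) ?fsubsetUl //.
rewrite (@cmeval_widen (finsupp m1 `|` finsupp m2)%fset m2) ?fsubsetUr //.
rewrite /cmeval mdomD -big_split /=.
by apply: eq_bigr => i _; rewrite cmM exprD.
Qed.

HB.instance Definition _ :=
  isMultiplicative.Build {cmonom I} S cmeval cmeval_mmorphism.

Lemma cmevalU i : cmeval (ucm i) = v i.
Proof. by rewrite /cmeval mdomU big_seq_fset1 cmUU expr1. Qed.

End MonomEval.

Section Ideal.
Context (R : comNzRingType).

Definition in_ideal (G : R -> Prop) (x : R) : Prop :=
  exists s : seq (R * R),
    (forall u, u \in s -> G u.2) /\ x = \sum_(u <- s) u.1 * u.2.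

End Ideal.

Section Words.
Context (d : nat).

(* (i, false) is the letter i and (i, true) is the letter i^T. *)
Definition letter : Type := ('I_d * bool)%type.
Definition word : Type := seq letter.

Definition letterT (x : letter) : letter := (x.1, ~~ x.2).
Definition wordT (w : word) : word := rev (map letterT w).

Definition wpow (b : word) (k : nat) : word := flatten (nseq k b).

Definition is_power_of_shorter (w : word) : Prop :=
  exists (b : word) (k : nat), (size b < size w)%N /\ w = wpow b k.

Definition primitive (w : word) : bool :=
  (w != [::]) &&
  [forall m : 'I_(size w), forall k : 'I_(size w).+1, w != wpow (take m w) k].

Lemma size_wpow b k : size (wpow b k) = (k * size b)%N.
Proof. by rewrite size_flatten /shape map_nseq sumn_nseq mulnC. Qed.

Lemma primitiveP (w : word) :
  reflect (w <> [::] /\ ~ is_power_of_shorter w) (primitive w).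
Proof.
apply: (iffP andP) => [[/eqP w0 /forallP H]|[/eqP w0 H]]; split=> //.
  move=> [b [k [lt_bw e]]].
  have sw : size w = (k * size b)%N by rewrite e size_wpow.
  have k0 : (0 < k)%N.
    by case: k e sw => // e _; case: w0; rewrite e.
  have b0 : (0 < size b)%N.
    by case: (size b) sw => // sw; case: w0; apply: size0nil; rewrite sw muln0.
  have eb : b = take (size b) w.
    by rewrite e; case: k k0 {e sw} => // k _; rewrite /wpow /= take_size_cat.
  have lk : (k < (size w).+1)%N by rewrite ltnS sw leq_pmulr.
  have /forallP/(_ (Ordinal lk)) := H (Ordinal lt_bw).
  by rewrite /= -eb -e eqxx.
apply/forallP=> m; apply/forallP=> k; apply/eqP=> e; apply: H.
by exists (take m w), k; split=> //; rewrite size_takel // ltnW.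
Qed.

Definition sim (a b : word) : bool :=
  has (fun k => (rot k a == b) || (rot k a == wordT b)) (iota 0 (size a).+1).

Lemma simP (a b : word) :
  reflect (exists k, rot k a = b \/ rot k a = wordT b) (sim a b).
Proof.
apply: (iffP hasP) => [[k _ /orP[]/eqP e]|[k H]]; first by exists k; left.
  by exists k; right.
have [le_k|gt_k] := leqP k (size a).
  exists k; first by rewrite mem_iota.
  by case: H => ->; rewrite eqxx ?orbT.
exists 0%N; first by rewrite mem_iota.
by move: H; rewrite rot_oversize ?rot0 ?(ltnW gt_k) // => -[] ->; rewrite eqxx ?orbT.
Qed.

Lemma letterTK : involutive letterT.
Proof. by case=> i b; rewrite /letterT /= negbK. Qed.

Lemma wordTK : involutive wordT.
Proof. by move=> w; rewrite /wordT map_rev revK (mapK letterTK). Qed.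

Lemma wordT_rot k w : exists l, wordT (rot k w) = rot l (wordT w).
Proof.
have [le_k|gt_k] := leqP k (size w); last first.
  by exists 0%N; rewrite rot_oversize ?rot0 // ltnW.
exists (size w - k)%N.
rewrite /wordT map_rot rev_rot /rotr size_rev size_map.
by [].
Qed.

Lemma rot_add_ex k l (w : word) : exists m, rot k (rot l w) = rot m w.
Proof.
have [lk|lk] := leqP k (size w); last first.
  by exists l; rewrite (@rot_oversize _ k) // size_rot ltnW.
have [ll|ll] := leqP l (size w); last first.
  by exists k; rewrite (@rot_oversize _ l) // ltnW.
by rewrite (rot_add_mod ll lk); eexists; reflexivity.
Qed.

Lemma rot_inv_ex k (w : word) : exists m, rot m (rot k w) = w.
Proof. by exists (size (rot k w) - k)%N; exact: rotK. Qed.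

Lemma sim_refl : reflexive sim.
Proof. by move=> a; apply/simP; exists 0%N; left; rewrite rot0. Qed.

Lemma sim_imp_sym a b : sim a b -> sim b a.
Proof.
move/simP=> [k [<-|e]]; apply/simP.
  by have [m e] := rot_inv_ex k a; exists m; left.
have -> : b = wordT (rot k a) by rewrite e wordTK.
have [l ->] := wordT_rot k a.
by have [m e'] := rot_inv_ex l (wordT a); exists m; right.
Qed.

Lemma sim_sym : symmetric sim.
Proof. by move=> a b; apply/idP/idP; exact: sim_imp_sym. Qed.

Lemma sim_trans : transitive sim.
Proof.
move=> b a c /simP[k ek] /simP[l el]; apply/simP.
case: ek => [ek|ek].
  by have [m em] := rot_add_ex l k a; exists m; rewrite -em ek.
have [l' el'] := wordT_rot l b.
have [m em] := rot_add_ex l' k a; exists m; rewrite -em ek -el'.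
by case: el => ->; [right|left; rewrite wordTK].
Qed.

Definition primword : Type := {w : word | primitive w}.

Definition psim (a b : primword) : bool := sim (val a) (val b).

Lemma psim_refl : reflexive psim. Proof. by move=> a; exact: sim_refl. Qed.
Lemma psim_sym : symmetric psim. Proof. by move=> a b; exact: sim_sym. Qed.
Lemma psim_trans : transitive psim.
Proof. by move=> b a c; exact: sim_trans. Qed.

Canonical psim_equiv := EquivRel psim psim_refl psim_sym psim_trans.

Definition primclass : Type := {eq_quot psim}.

Definition posnat : Type := {t : nat | (0 < t)%N}.

Definition sigma_idx : choiceType := (posnat * primclass)%type.

End Words.

Definition Nsigma (F : fieldType) (d : nat) : comNzRingType :=
  {malg F[{cmonom (sigma_idx d)}]}.

(* The free generator sigma_t(a) of N_sigma. *)
Definition sigma_sym (F : fieldType) (d : nat) (t : posnat) (a : primword d) :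
  Nsigma F d :=
  pvar F ((t, \pi_(primclass d) a)%qT : sigma_idx d).

Section SigmaCoef.
Context (R : comNzRingType) (n : nat).

Definition det_lambda (A : 'M[R]_n) : {poly R} :=
  \det (map_mx polyC A + 'X%:M).

(* Meaningful for t <= n only: the subtraction is truncated. *)
Definition sigma (t : nat) (A : 'M[R]_n) : R := (det_lambda A)`_(n - t).

Lemma det_lambdaE (A : 'M[R]_n) :
  det_lambda A = \sum_(t < n.+1) sigma t A *: 'X^(n - t).
Proof.
have sz : (size (det_lambda A) <= n.+1)%N.
  have <- : char_poly (- A) = det_lambda A.
    by rewrite /char_poly /char_poly_mx /det_lambda map_mxN opprK addrC.
  by rewrite size_char_poly.
rewrite -[LHS]coefK poly_def.
rewrite (big_ord_widen n.+1 (fun i => (det_lambda A)`_i *: 'X^i) sz).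
rewrite big_mkcond /= (reindex_inj rev_ord_inj) /=.
apply: eq_bigr => i _; rewrite subSS /sigma.
by case: ltnP => // /(nth_default 0) ->; rewrite scale0r.
Qed.

Lemma det_lambdaC (A B : 'M[R]_n) : det_lambda (A *m B) = det_lambda (B *m A).
Proof.
rewrite /det_lambda !map_mxM /=; set a := map_mx _ A; set b := map_mx _ B.
pose M := block_mx 'X%:M a (- b) 1%:M.
have e1 : \det M = \det (a *m b + 'X%:M).
  have : M *m block_mx 1%:M 0 b 1%:M = block_mx (a *m b + 'X%:M) a 0 1%:M.
    rewrite mulmx_block !(mulmx1, mul1mx, mulmx0, add0r, addr0).
    by rewrite addNr addrC.
  move/(congr1 determinant).
  by rewrite det_mulmx det_lblock det_ublock !det1 !mulr1.
have e2 : 'X^n * \det M = 'X^n * \det (b *m a + 'X%:M).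
  have : block_mx 1%:M 0 b 'X%:M *m M = block_mx 'X%:M a 0 (b *m a + 'X%:M).
    rewrite mulmx_block !(mulmx1, mul1mx, mul0mx, addr0).
    by rewrite scalar_mxC mulmxN addrN.
  move/(congr1 determinant).
  by rewrite det_mulmx det_lblock det_ublock !det_scalar expr1n !mul1r.
by rewrite -e1; apply: (monic_lreg (monicXn R n)).
Qed.

Lemma det_lambdaT (A : 'M[R]_n) : det_lambda A^T = det_lambda A.
Proof.
by rewrite /det_lambda -map_trmx -tr_scalar_mx -linearD det_tr tr_scalar_mx.
Qed.

End SigmaCoef.

Section Psi.
Context (F : fieldType) (d : nat).

(* x_ij(k) is the variable (i, j, k). *)
Definition Rn_idx (n : nat) : choiceType := ('I_n * 'I_n * 'I_d)%type.
Definition Rn (n : nat) : comNzRingType := {malg F[{cmonom (Rn_idx n)}]}.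

Definition generic_mx (n : nat) (k : 'I_d) : 'M[Rn n]_n :=
  \matrix_(i, j) pvar F ((i, j, k) : Rn_idx n).

Definition letter_mx (n : nat) (x : letter d) : 'M[Rn n]_n :=
  if x.2 then (generic_mx n x.1)^T else generic_mx n x.1.

Definition word_mx (n : nat) (w : word d) : 'M[Rn n]_n :=
  \prod_(x <- w) letter_mx n x.

(* Value of Psi_n on a generator, computed on the representative chosen by the
   quotient; Psi_sigma below shows that the choice is irrelevant. *)
Definition Psi_gen (n : nat) (i : sigma_idx d) : Rn n :=
  let t := val i.1 in
  if (t <= n)%N then sigma t (word_mx n (val (repr i.2))) else 0.

Definition Psi (n : nat) : Nsigma F d -> Rn n :=
  mmap (@malgC {cmonom (Rn_idx n)} F) (cmeval (@Psi_gen n)).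

Lemma Psi_zmod_morphism n : zmod_morphism (@Psi n).
Proof. exact: raddfB. Qed.
Lemma Psi_monoid_morphism n : monoid_morphism (@Psi n).
Proof. split; [exact: rmorph1 | exact: rmorphM]. Qed.
HB.instance Definition _ n :=
  GRing.isZmodMorphism.Build (Nsigma F d) (Rn n) (@Psi n) (Psi_zmod_morphism n).
HB.instance Definition _ n :=
  GRing.isMonoidMorphism.Build (Nsigma F d) (Rn n) (@Psi n) (Psi_monoid_morphism n).

Lemma PsiC n (c : F) : Psi n c%:MP = c%:MP.
Proof. exact: mmapC. Qed.

Lemma word_mx_cat n a b : word_mx n (a ++ b) = word_mx n a *m word_mx n b.
Proof. by rewrite /word_mx big_cat. Qed.

Lemma letter_mxT n x : letter_mx n (letterT x) = (letter_mx n x)^T.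
Proof. by case: x => i [] //=; rewrite /letter_mx /= trmxK. Qed.

Lemma word_mxT n w : word_mx n (wordT w) = (word_mx n w)^T.
Proof.
elim: w => [|x w IH]; first by rewrite /word_mx !big_nil trmx1.
rewrite /wordT /= rev_cons -cats1 word_mx_cat -/(wordT w) IH.
by rewrite /word_mx big_seq1 big_cons trmx_mul letter_mxT.
Qed.

Lemma sigma_sim n t a b :
  sim a b -> sigma t (word_mx n a) = sigma t (word_mx n b).
Proof.
have rotE k w : det_lambda (word_mx n (rot k w)) = det_lambda (word_mx n w).
  rewrite -[in RHS](cat_take_drop k w) /rot !word_mx_cat.
  exact: det_lambdaC.
move=> /simP[k e]; rewrite /sigma.
suff: det_lambda (word_mx n a) = det_lambda (word_mx n b) by move=> ->.
apply: etrans (esym (rotE k a)) _.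
by case: e => ->; [|rewrite word_mxT; exact: det_lambdaT].
Qed.

Lemma Psi_sigma n (t : posnat) (a : primword d) :
  Psi n (sigma_sym F t a) =
  if (val t <= n)%N then sigma (val t) (word_mx n (val a)) else 0.
Proof.
apply: etrans (mmapU _ _) _; apply: etrans (mul1r _) _.
rewrite cmevalU /Psi_gen /=.
have e : sim (val (repr (\pi_(primclass d) a)%qT)) (val a).
  by rewrite -[sim _ _]/(psim _ _) -eqmodE; apply/eqP; rewrite reprK.
by rewrite (sigma_sim n (val t) e).
Qed.

Definition K (n : nat) (f : Nsigma F d) : Prop := Psi n f = 0.

Definition free_relation (f : Nsigma F d) : Prop :=
  forall n : nat, (0 < n)%N -> K n f.

End Psi.

Definition infinite_type (T : eqType) : Prop :=
  forall s : seq T, exists x, x \notin s.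

(* Main.v *)
Require Import Defs.
From HB Require Import structures.
From mathcomp Require Import all_boot all_order all_algebra all_fingroup.
From mathcomp Require Import generic_quotient finmap ring zify mxtens.
From mathcomp.multinomials Require Import monalg.

(* Free relations vanish outright in every characteristic other than 2. It
   suffices to find, over R = N_sigma with a square root i of -1 adjoined,
   matrices X_k whose values sigma_t(X_alpha) are the free generators
   sigma_t(alpha) for any prescribed finite set of pairs (t, alpha): then
   f(X) = f, while f(X) = 0 for a free relation f.

   Since det(1 + s X_alpha) = sum_t s^t sigma_t(X_alpha) is multiplicative on
   direct sums, one class alpha can be treated at a time. In a hyperbolic space
   V + V^* (isometric to a space with the standard form, thanks to i and 1/2)
   the letters x and x^T act on V by independent matrices Y_x and Y_{x^T}, and
   det(1 + s X_beta) = det(1 + s Y_beta) det(1 + s Y_{beta^T}). Let Y act along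
   a cycle whose edges spell alpha, the closing edge carrying a matrix C. Then
   det(1 + s Y_alpha) = det(1 + s C) is arbitrary for a companion matrix C, and
   det(1 + s Y_beta) = 1 if beta is primitive and not a rotation of alpha, since
   a closed walk spelling a power of beta would force beta^oo to be a shift of
   alpha^oo. When alpha^T is a rotation of alpha the value is the square
   det(1 + s C)^2, and a truncated square root (1/2 again) makes up for it. *)

Set Implicit Arguments.
Unset Strict Implicit.
Unset Printing Implicit Defensive.

Import GRing.Theory.
Local Open Scope ring_scope.

(** * Coefficients of det(1 + X A) *)

(** The reversed characteristic polynomial of [- A]. Its coefficients are indexed by t whatever the
    size n, so values at blocks of different sizes can be multiplied. *)
Definition detl (R : comNzRingType) (n : nat) (A : 'M[R]_n) : {poly R} :=
  \det (1%:M + 'X *: map_mx polyC A).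

Lemma coef_comp_polyZX (R : comNzRingType) (p : {poly R}) (c : R) k :
  (p \Po (c *: 'X))`_k = p`_k * c ^+ k.
Proof.
rewrite comp_polyE coef_sum.
under eq_bigr => i _ do rewrite exprZn scalerA coefZ coefXn.
have [lt_k|le_k] := ltnP k (size p); last first.
  rewrite (nth_default _ le_k) mul0r big1 // => i _.
  by rewrite gtn_eqF ?mulr0 // (leq_trans (ltn_ord i)).
rewrite (bigD1 (Ordinal lt_k)) //= eqxx mulr1 big1 ?addr0 // => i ik.
by rewrite eq_sym -[k]/(nat_of_ord (Ordinal lt_k)) (negPf (ik : nat_of_ord i != _)) mulr0.
Qed.

Lemma det_lambda_map (R S : comNzRingType) (f : {rmorphism R -> S}) n
  (A : 'M[R]_n) : det_lambda (map_mx f A) = map_poly f (det_lambda A).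
Proof.
rewrite /det_lambda -det_map_mx; congr (\det _).
by apply/matrixP => i j; rewrite !mxE rmorphD /= map_polyC rmorphMn /= map_polyX.
Qed.

Lemma sigma_map (R S : comNzRingType) (f : {rmorphism R -> S}) n t
  (A : 'M[R]_n) : sigma t (map_mx f A) = f (sigma t A).
Proof. by rewrite /sigma det_lambda_map coef_map. Qed.

(** Compare coefficients in det(cA + cX) = c^n det(A + X), then cancel c^(n - t). *)
Lemma sigma_scale (R : comNzRingType) n t (c : R) (A : 'M[R]_n) :
  GRing.lreg c -> (t <= n)%N -> sigma t (c *: A) = c ^+ t * sigma t A.
Proof.
move=> creg le_tn.
have e : det_lambda (c *: A) \Po (c *: 'X) = (c ^+ n) *: det_lambda A.
  rewrite -[RHS]mul_polyC polyC_exp -detZ /det_lambda -det_map_mx.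
  congr (\det _); apply/matrixP => i j; rewrite !mxE rmorphD /= rmorphMn /=.
  by rewrite comp_polyX comp_polyC mulrDr polyCM mulrnAr -[c *: 'X]mul_polyC.
have := congr1 (fun p : {poly R} => p`_(n - t)) e.
rewrite coef_comp_polyZX coefZ mulrC => e'.
apply: (@lregX _ c (n - t) creg); rewrite /= /sigma e' mulrA -exprD.
by rewrite subnK.
Qed.

Lemma detl_sigma (R : comNzRingType) n (A : 'M[R]_n) :
  detl A = \sum_(t < n.+1) sigma t A *: 'X^t.
Proof.
(* The variable of [det_lambda] is set to 1 while the new variable ['X] scales the matrix;
   [sigma_scale] then extracts X^t. *)
have -> : detl A = (det_lambda ('X *: map_mx polyC A)).[1].
  rewrite /det_lambda -horner_evalE -det_map_mx; congr (\det _).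
  apply/matrixP => i j; rewrite !mxE rmorphD /= rmorphMn /=.
  by rewrite !horner_evalE hornerC hornerX addrC.
rewrite det_lambdaE horner_sum; apply: eq_bigr => t _.
rewrite hornerZ hornerXn expr1n mulr1 sigma_scale ?leq_ord //; last first.
  exact: (monic_lreg (monicX R)).
by rewrite sigma_map mulrC mul_polyC.
Qed.

Lemma coef_detl (R : comNzRingType) n (A : 'M[R]_n) t :
  (detl A)`_t = if (t <= n)%N then sigma t A else 0.
Proof.
rewrite detl_sigma -(poly_def n.+1 (fun t => sigma t A)) coef_poly ltnS.
by [].
Qed.

(** Sylvester's identity: a unitriangular factor on the right or on the left of [M] exposes one side
    or the other. With rectangular factors it also moves a determinant to a smaller space. *)
Lemma det_add1_mulC (R : comNzRingType) m n (A : 'M[R]_(m, n)) (B : 'M_(n, m)) :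
  \det (1%:M + A *m B) = \det (1%:M + B *m A).
Proof.
pose M := block_mx 1%:M (- A) B 1%:M.
transitivity (\det M).
  have : M *m block_mx 1%:M 0 (- B) 1%:M = block_mx (1%:M + A *m B) (- A) 0 1%:M.
    rewrite mulmx_block !(mulmx1, mul1mx, mulmx0, add0r, addr0).
    by rewrite mulNmx mulmxN opprK subrr.
  move/(congr1 determinant).
  by rewrite det_mulmx det_lblock det_ublock !det1 !mulr1.
have : block_mx 1%:M 0 (- B) 1%:M *m M = block_mx 1%:M (- A) 0 (1%:M + B *m A).
  rewrite mulmx_block !(mulmx1, mul1mx, mul0mx, addr0).
  by rewrite addNr mulNmx mulmxN opprK addrC.
move/(congr1 determinant).
by rewrite det_mulmx det_lblock det_ublock !det1 !mul1r.
Qed.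

Lemma detl_mulC (R : comNzRingType) m n (A : 'M[R]_(m, n)) (B : 'M_(n, m)) :
  detl (A *m B) = detl (B *m A).
Proof. by rewrite /detl !map_mxM !scalemxAl det_add1_mulC -scalemxAl -scalemxAr. Qed.

Lemma detl_block (R : comNzRingType) m n (A : 'M[R]_m) (B : 'M_n) :
  detl (block_mx A 0 0 B) = detl A * detl B.
Proof.
rewrite /detl map_block_mx !map_mx0 scale_block_mx !scaler0.
by rewrite (scalar_mx_block m n) add_block_mx !addr0 det_ublock.
Qed.

Lemma detl_tr (R : comNzRingType) n (A : 'M[R]_n) : detl A^T = detl A.
Proof.
by rewrite /detl -[RHS]det_tr linearD linearZ /= trmx1 map_trmx.
Qed.

Lemma exists_detl (R : comNzRingType) (T : nat) (P : {poly R}) : P`_0 = 1 ->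
  exists N (C : 'M[R]_N), forall t, (t <= T)%N -> (detl C)`_t = P`_t.
Proof.
(* [q] is P cut at degree T and reversed. The constant term 1 becomes the leading coefficient, so
   [q] is the characteristic polynomial of its companion matrix. *)
move=> P0; pose q := \poly_(i < T.+1) P`_(T - i).
have szq : size q = T.+1 by rewrite size_poly_eq // subnn P0 oner_neq0.
have qmonic : q \is monic by rewrite monicE lead_coefE szq coef_poly ltnSn subnn P0.
exists (size q).-1, (- companionmx q) => t le_t.
have le_t' : (t <= (size q).-1)%N by rewrite szq.
rewrite coef_detl le_t' /sigma.
have -> : det_lambda (- companionmx q) = char_poly (companionmx q).
  by rewrite /char_poly /char_poly_mx /det_lambda map_mxN addrC.
by rewrite companionmxK // szq coef_poly ltnS leq_subr subKn.
Qed.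

(** As Q has constant term 1, adding c X^(T+1) changes the coefficient of Q^2 in degree T+1 by 2c
    and none below; so c is half the defect. *)
Lemma exists_sqrt (R : comNzRingType) (h : R) (T : nat) (P : {poly R}) :
  h *+ 2 = 1 -> P`_0 = 1 ->
  exists Q : {poly R}, Q`_0 = 1 /\ forall t, (t <= T)%N -> (Q * Q)`_t = P`_t.
Proof.
move=> h2 P0; elim: T => [|T [Q [Q0 IH]]].
  by exists 1; rewrite coef1; split=> // -[|//] _; rewrite mulr1 coef1.
pose c := h * (P`_T.+1 - (Q * Q)`_T.+1).
have cc : c + c = P`_T.+1 - (Q * Q)`_T.+1 by rewrite -mulr2n -mulrnAl h2 mul1r.
move: c cc => c cc; exists (Q + c *: 'X^(T.+1)); split.
  by rewrite coefD coefZ coefXn mulr0 addr0.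
move=> t le_t.
have -> : (Q + c *: 'X^(T.+1)) * (Q + c *: 'X^(T.+1)) =
  Q * Q + (Q *+ 2 * c%:P + (c * c)%:P * 'X^(T.+1)) * 'X^(T.+1).
  by rewrite -(mul_polyC c 'X^(T.+1)) polyCM; ring.
rewrite coefD coefMXn; case: ltnP => [lt_t|ge_t]; first by rewrite addr0 IH.
have -> : t = T.+1 by apply/eqP; rewrite eqn_leq le_t.
rewrite subnn coefD coefMC coefMXn addr0 coefMn Q0.
rewrite mulrnAl mul1r mulr2n cc; ring.
Qed.

(** Congruence modulo X^(T+1). *)
Definition eqtr (R : nzRingType) (T : nat) (p q : {poly R}) :=
  forall t, (t <= T)%N -> p`_t = q`_t.

Lemma eqtrM (R : comNzRingType) T (p q p' q' : {poly R}) :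
  eqtr T p p' -> eqtr T q q' -> eqtr T (p * q) (p' * q').
Proof.
move=> ep eq t le_t; rewrite !coefM; apply: eq_bigr => i _.
by rewrite ep ?eq // (leq_trans _ le_t) ?leq_subr // leq_ord.
Qed.

(** * Hyperbolic matrices over R[i] *)

(* The ring R[i] = R[x]/(x^2 + 1): the pair (a, b) stands for a + i b. *)
Definition gauss (R : comNzRingType) : Type := (R * R)%type.

Section Gauss.
Context (R : comNzRingType).
Implicit Types x y z : gauss R.

HB.instance Definition _ := GRing.Zmodule.copy (gauss R) (R * R)%type.

Definition gauss_one : gauss R := (1, 0).
Definition gauss_mul x y : gauss R :=
  (x.1 * y.1 - x.2 * y.2, x.1 * y.2 + x.2 * y.1).

Lemma gauss_mulA : associative gauss_mul.
Proof. by move=> [a b] [c e] [g k]; congr pair => /=; ring. Qed.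

Lemma gauss_mulC : commutative gauss_mul.
Proof. by move=> [a b] [c e]; congr pair => /=; ring. Qed.

Lemma gauss_mul1 : left_id gauss_one gauss_mul.
Proof. by move=> [a b]; congr pair => /=; ring. Qed.

Lemma gauss_mulDl : left_distributive gauss_mul +%R.
Proof. by move=> [a b] [c e] [g k]; congr pair => /=; ring. Qed.

Lemma gauss_one_neq0 : gauss_one != 0.
Proof. by apply/eqP => -[] /eqP; rewrite oner_eq0. Qed.

HB.instance Definition _ := GRing.Zmodule_isComNzRing.Build (gauss R)
  gauss_mulA gauss_mulC gauss_mul1 gauss_mulDl gauss_one_neq0.

Definition gaussC (a : R) : gauss R := (a, 0).
Definition gaussi : gauss R := (0, 1).

Lemma gaussC_inj : injective gaussC.
Proof. by move=> a b []. Qed.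

Lemma gaussC_zmod_morphism : zmod_morphism gaussC.
Proof. by move=> a b; congr pair; rewrite /= subr0. Qed.

Lemma gaussC_monoid_morphism : monoid_morphism gaussC.
Proof. by split=> // a b; congr pair => /=; ring. Qed.

HB.instance Definition _ :=
  GRing.isZmodMorphism.Build R (gauss R) gaussC gaussC_zmod_morphism.
HB.instance Definition _ :=
  GRing.isMonoidMorphism.Build R (gauss R) gaussC gaussC_monoid_morphism.

Lemma gaussi_sqr : gaussi * gaussi = -1.
Proof. by congr pair => /=; ring. Qed.

End Gauss.

(** A letter and its transpose may receive unrelated matrices here; [orth_letter] gives the
    assignments that respect transposition. *)
Definition mxword (R : comNzRingType) (d n : nat) (Y : letter d -> 'M[R]_n)
  (w : word d) : 'M[R]_n := foldr (fun x A => Y x *m A) 1%:M w.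

Lemma mxword_cat (R : comNzRingType) (d n : nat) (Y : letter d -> 'M[R]_n) u v :
  mxword Y (u ++ v) = mxword Y u *m mxword Y v.
Proof. by elim: u => [|x u IH] /=; rewrite ?mul1mx // IH mulmxA. Qed.

Definition orth_letter (R : comNzRingType) (d n : nat) (M : 'I_d -> 'M[R]_n)
  (x : letter d) : 'M[R]_n := if x.2 then (M x.1)^T else M x.1.

Section Hyperbolic.
Context (R : comNzRingType) (d m : nat) (i h : R).
Hypotheses (ii : i * i = -1) (h2 : h *+ 2 = 1).
Context (Y : letter d -> 'M[R]_m).

(** The rows of [U] and [V] are dual bases of two complementary totally isotropic subspaces for the
    standard form. *)
Let U : 'M[R]_(m, m + m) := row_mx 1%:M i%:M.
Let V : 'M[R]_(m, m + m) := row_mx h%:M (- (i * h))%:M.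

Let UU : U *m U^T = 0.
Proof.
rewrite tr_row_mx mul_row_col !tr_scalar_mx -!scalar_mxM -raddfD /=.
by rewrite ii mul1r subrr raddf0.
Qed.

Let VV : V *m V^T = 0.
Proof.
rewrite tr_row_mx mul_row_col !tr_scalar_mx -!scalar_mxM -raddfD /=.
rewrite mulrNN mulrACA ii mulN1r subrr; exact: raddf0.
Qed.

Let UV : U *m V^T = 1%:M.
Proof.
rewrite tr_row_mx mul_row_col !tr_scalar_mx -!scalar_mxM -raddfD /=.
by rewrite mulrN mulrA ii mulN1r opprK mul1r -mulr2n h2.
Qed.

Let VU : V *m U^T = 1%:M.
Proof. by rewrite -[LHS]trmxK trmx_mul trmxK UV trmx1. Qed.

(** In the basis given by [U] and [V] this is the block diagonal matrix of Y_k and the transpose of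
    Y_{k^T}; transposition exchanges the roles of k and k^T. *)
Definition hyperbolic (k : 'I_d) : 'M[R]_(m + m) :=
  V^T *m Y (k, false) *m U + U^T *m (Y (k, true))^T *m V.

Let P := row_mx V^T U^T.
Let Q := col_mx U V.

Let QP : Q *m P = 1%:M.
Proof. by rewrite mul_col_row UU UV VV VU -scalar_mx_block. Qed.

Let diag A B : P *m block_mx A 0 0 B *m Q = V^T *m A *m U + U^T *m B *m V.
Proof. by rewrite mul_row_block !mulmx0 addr0 add0r mul_row_col. Qed.

(** The inner factors [Q *m P] cancel. The second block reverses the order of the factors, just as
    [wordT] does. *)
Lemma hyperbolic_word w : mxword (orth_letter hyperbolic) w =
  P *m block_mx (mxword Y w) 0 0 (mxword Y (wordT w))^T *m Q.
Proof.
elim: w => [|x w IH] /=.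
  rewrite trmx1 -scalar_mx_block mulmx1; exact: esym (mulmx1C QP).
have -> : orth_letter hyperbolic x =
    P *m block_mx (Y x) 0 0 (Y (letterT x))^T *m Q.
  rewrite diag; case: x => k [] /=; rewrite /orth_letter /letterT /hyperbolic //=.
  by rewrite linearD /= !trmx_mul !trmxK addrC !mulmxA.
rewrite IH !mulmxA -(mulmxA _ Q P) QP mulmx1 -(mulmxA P) mulmx_block.
rewrite !mul0mx !mulmx0 !addr0 !add0r -trmx_mul.
by rewrite /wordT /= rev_cons -cats1 mxword_cat /= mulmx1.
Qed.

Lemma detl_hyperbolic w : detl (mxword (orth_letter hyperbolic) w) =
  detl (mxword Y w) * detl (mxword Y (wordT w)).
Proof.
by rewrite hyperbolic_word -mulmxA detl_mulC -mulmxA QP mulmx1 detl_block detl_tr.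
Qed.

End Hyperbolic.

(** * Powers and rotations of words *)

Section WordCombinatorics.
Context (d : nat).
Implicit Types u v w x y : word d.

Lemma wpowD u a b : wpow u (a + b) = wpow u a ++ wpow u b.
Proof. by rewrite /wpow nseqD flatten_cat. Qed.

(** Euclid's algorithm on lengths: the shorter word is a prefix of the longer one, and it commutes
    with what remains after removing it. *)
Lemma commute_common_power x y : x ++ y = y ++ x ->
  exists u a b, x = wpow u a /\ y = wpow u b.
Proof.
have [n] := ubnP (size x + size y); elim: n x y => // n IH.
have step x y : (size x <= size y)%N -> (size x + size y < n.+1)%N ->
    x ++ y = y ++ x -> exists u a b, x = wpow u a /\ y = wpow u b.
  case: x => [|c x] le_xy lt_n e.
    by exists y, 0, 1; split=> //; rewrite /wpow /= cats0.
  have ey : y = (c :: x) ++ drop (size (c :: x)) y.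
    rewrite -[LHS](cat_take_drop (size (c :: x))); congr (_ ++ _).
    by have := congr1 (take (size (c :: x))) e; rewrite take_size_cat // takel_cat.
  set z := drop _ _ in ey.
  have ez : (c :: x) ++ z = z ++ (c :: x).
    by move: e; rewrite ey -catA => /eqP; rewrite eqseq_cat // eqxx => /eqP.
  have [|u [a [b [ea eb]]]] := IH _ _ _ ez.
    move: lt_n; rewrite {1}ey size_cat /= => lt_n; lia.
  by exists u, a, (a + b)%N; split=> //; rewrite wpowD -ea -eb.
move=> x y lt_n e; case: (leqP (size x) (size y)) => [le|lt]; first exact: step.
have [|u [a [b [ea eb]]]] := step y x (ltnW lt) _ (esym e); first by rewrite addnC.
by exists u, b, a.
Qed.

Lemma rot1_wpow w a : exists w', size w' = size w /\ rot 1 (wpow w a) = wpow w' a.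
Proof.
case: w => [|c w]; first by exists [::]; split=> //; elim: a => //.
exists (rcons w c); rewrite size_rcons; split=> //.
have shift k : wpow (c :: w) k ++ [:: c] = c :: wpow (rcons w c) k.
  elim: k => // k IHk; rewrite /wpow /= in IHk *.
  by rewrite -catA IHk -cats1 -catA.
case: a => // a; rewrite /wpow /= rot1_cons -cats1 -catA shift.
by rewrite -cats1 -catA.
Qed.

Lemma rot_wpow k w a : (k <= size (wpow w a))%N ->
  exists w', size w' = size w /\ rot k (wpow w a) = wpow w' a.
Proof.
elim: k => [|k IH] lek; first by exists w; rewrite rot0.
have [w' [sz e]] := IH (ltnW lek); have [w2 [sz2 e2]] := rot1_wpow w' a.
by exists w2; rewrite sz2 sz -e2 -e -rotD.
Qed.

(** Rotating back turns a power into a power of a word of the same length. *)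
Lemma primitive_rot k w : primitive w -> primitive (rot k w).
Proof.
case/primitiveP=> w0 H; apply/primitiveP; split.
  by move/(congr1 size); rewrite size_rot => /size0nil.
move=> [b [c []]]; rewrite size_rot => ltb e.
have [|w' [sz e']] := @rot_wpow (size (rot k w) - k) b c.
  by rewrite -e leq_subr.
by apply: H; exists w', c; rewrite sz -e' -e -/(rotr k _) rotK.
Qed.

Lemma wordT_cat u v : wordT (u ++ v) = wordT v ++ wordT u.
Proof. by rewrite /wordT map_cat rev_cat. Qed.

Lemma wordT_wpow u a : wordT (wpow u a) = wpow (wordT u) a.
Proof.
elim: a => // a IH; rewrite -addn1 wpowD wordT_cat IH addnC wpowD.
by rewrite /wpow /= !cats0.
Qed.

Lemma size_wordT w : size (wordT w) = size w.
Proof. by rewrite size_rev size_map. Qed.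

Lemma primitive_wordT w : primitive w -> primitive (wordT w).
Proof.
case/primitiveP=> w0 H; apply/primitiveP; split.
  by move/(congr1 size); rewrite size_wordT => /size0nil.
move=> [b [c []]]; rewrite size_wordT => ltb e.
by apply: H; exists (wordT b), c; rewrite size_wordT -wordT_wpow -e wordTK.
Qed.

Lemma primitive_wpow u a : primitive (wpow u a) -> wpow u a = u.
Proof.
case/primitiveP=> w0 H; case: a w0 H => [|[|a]] // w0 H.
  by rewrite /wpow /= cats0.
case: H; exists u, a.+2; split=> //; rewrite size_wpow.
have : (0 < size u)%N.
  by case: u w0 => // w0; case: w0; apply: size0nil; rewrite size_wpow muln0.
by move=> u0; rewrite -[X in (X < _)%N]mul1n ltn_mul2r u0.
Qed.

Lemma primitive_commute x y : primitive x -> primitive y ->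
  x ++ y = y ++ x -> x = y.
Proof.
move=> px py /commute_common_power [u [a [b [ex ey]]]].
rewrite ex ey in px py *.
by rewrite (primitive_wpow px) (primitive_wpow py).
Qed.

(** The two parts of w commute, hence are powers of one word u. Primitivity gives w = u, so the
    prefix of length k < |w| is the power 0. *)
Lemma primitive_rot_id k w : primitive w -> (k < size w)%N -> rot k w = w ->
  k = 0%N.
Proof.
move=> pw ltk; rewrite /rot -[X in _ = X](cat_take_drop k w) => e.
have [u [a [b [ey ex]]]] := commute_common_power e.
have := pw; rewrite -(cat_take_drop k w) ey ex -wpowD => p'.
have := primitive_wpow p'; rewrite wpowD -ey -ex cat_take_drop => ew.
move: ex => /(congr1 size); rewrite size_wpow -ew size_takel ?(ltnW ltk) //.
case: b {p' ew} => // b; rewrite mulSn => ek.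
by move: ltk; rewrite ek -ltn_subRL subnn.
Qed.

(** A weak form of the Fine-Wilf theorem: uv is a prefix of u^oo, vu is one of v^oo, and these agree
    up to length |u| + |v|. *)
Lemma same_periodic_extension (x0 : letter d) u v : u != [::] -> v != [::] ->
  (forall n, (n < size u + size v)%N ->
     nth x0 u (n %% size u) = nth x0 v (n %% size v)) ->
  u ++ v = v ++ u.
Proof.
rewrite -!size_eq0 -!lt0n => u0 v0 H.
have gen s t : (0 < size s)%N -> (0 < size t)%N ->
   (forall n, (n < size s + size t)%N ->
     nth x0 s (n %% size s) = nth x0 t (n %% size t)) ->
   forall n, (n < size s + size t)%N ->
   nth x0 (s ++ t) n = nth x0 s (n %% size s).
  move=> s0 t0 K n ltn; rewrite nth_cat; case: ltnP => [lt|ge].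
    by rewrite modn_small.
  rewrite -[in RHS](subnK ge) modnDr K; last by lia.
  by rewrite modn_small // ltn_subLR.
apply: (@eq_from_nth _ x0); first by rewrite !size_cat addnC.
move=> n; rewrite size_cat => ltn; rewrite (gen u v) // (gen v u) //.
- exact: H.
- by move=> k; rewrite addnC => /H.
- by rewrite addnC.
Qed.

End WordCombinatorics.

(** * Matrices of a labelled cycle *)

(** In the Leibniz expansion constant walks kill the diagonal of A, and a permutation other than the
    identity has a nontrivial cycle, along which some entry of A vanishes. *)
Lemma det_add1_acyclic (R : comNzRingType) n (A : 'M[R]_n) :
  (forall u : nat -> 'I_n, exists k, A (u k) (u k.+1) = 0) ->
  \det (1%:M + A) = 1.
Proof.
move=> acyc; rewrite /determinant (bigD1 1%g) //= odd_perm1 mul1r.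
rewrite big1 => [|i _]; last first.
  have [k Aii] := acyc (fun=> i).
  by rewrite perm1 !mxE eqxx Aii addr0.
rewrite big1 ?addr0 // => s s1.
have [i si] : exists i, s i != i.
  apply/existsP; rewrite -negb_forall; apply: contra s1 => /forallP s1.
  by apply/eqP/permP => i; rewrite perm1; apply/eqP.
(* The walk is the orbit of the moved point i. Every point of it is moved, so the identity matrix
   contributes nothing to the factor found here. *)
have [k Ak] := acyc (fun k => (s ^+ k)%g i).
rewrite (bigD1 ((s ^+ k)%g i)) //= -[s (_ i)]permM -expgSr !mxE Ak addr0.
suff /negPf -> : (s ^+ k)%g i != (s ^+ k.+1)%g i by rewrite mul0r mulr0.
by rewrite expgS permM (inj_eq perm_inj) eq_sym.
Qed.

Section CyclicGraph.
Context (R : comNzRingType) (d : nat) (x0 : letter d) (g : word d).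
Hypothesis g0 : (0 < size g)%N.
Context (N : nat) (C : 'M[R]_N).

Let dim := (size g * N)%N.

(** Projection onto the space at vertex b mod |g|; natural number indices let walks go round the
    cycle. *)
Let J (b : nat) : 'M[R]_(N, dim) :=
  \matrix_(a, j) (((mxtens_unindex j).1 == (b %% size g)%N :> nat)
                  && ((mxtens_unindex j).2 == a))%:R.

Let W (b : nat) : 'M[R]_N := if (b.+1 %% size g == 0)%N then C else 1%:M.

(* The cycle of length |g| whose b-th edge carries the b-th letter of g; every
   vertex is an N-dimensional space, the closing edge acts by C and all others
   by the identity. *)
Definition cyclic_graph (x : letter d) : 'M[R]_dim :=
  \sum_(b < size g | nth x0 g b == x) (J b)^T *m W b *m J b.+1.

Lemma J_mod b : J (b %% size g)%N = J b.
Proof. by apply/matrixP => a j; rewrite !mxE modn_mod. Qed.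

Lemma J_mul_tr b c : J b *m (J c)^T = (b == c %[mod size g])%:R%:M.
Proof.
apply/matrixP => a a'; rewrite !mxE.
have bg : (b %% size g < size g)%N by rewrite ltn_mod.
rewrite (bigD1 (mxtens_index (Ordinal bg, a))) //= big1 => [|j nj].
  by rewrite !mxE mxtens_indexK /= !eqxx mul1r addr0; case: eqP; rewrite ?mulr0n //= ; case: eqP.
rewrite !mxE; case: eqP => // e1; case: eqP => e2; rewrite /= ?mul0r //.
case/eqP: nj; rewrite -(mxtens_unindexK j); congr mxtens_index.
by rewrite [LHS]surjective_pairing; congr pair => //; apply: val_inj.
Qed.

Lemma nth_rot_mod b n : (b < size g)%N ->
  nth x0 (rot b g) (n %% size g) = nth x0 g ((b + n) %% size g)%N.
Proof.
move=> ltb; have ltn : (n %% size g < size g)%N by rewrite ltn_mod.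
rewrite -[in RHS]modnDmr; move: (n %% size g)%N ltn => {}n ltn.
rewrite /rot nth_cat size_drop; case: ltnP => [lt|ge].
  by rewrite nth_drop modn_small //; lia.
rewrite nth_take; last by lia.
have -> : (b + n = (n - (size g - b)) + size g)%N by lia.
by rewrite modnDr modn_small //; lia.
Qed.

(** The weight of the only walk from vertex b that can spell w; a mismatch with the labels gives
    0. *)
Fixpoint along (b : nat) (w : word d) : 'M[R]_N :=
  if w is x :: w' then
    if nth x0 g (b %% size g)%N == x then W b *m along b.+1 w' else 0
  else 1%:M.

Lemma J_mxword b w : J b *m mxword cyclic_graph w = along b w *m J (b + size w).
Proof.
elim: w b => [|x w IH] b /=; first by rewrite mul1mx mulmx1 addn0.
rewrite mulmxA.
have -> : J b *m cyclic_graph x =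
    if nth x0 g (b %% size g)%N == x then W b *m J b.+1 else 0.
  have bg : (b %% size g < size g)%N by rewrite ltn_mod.
  rewrite /cyclic_graph mulmx_sumr.
  have z (c : 'I_(size g)) : c != Ordinal bg ->
      J b *m ((J c)^T *m W c *m J c.+1) = 0.
    move=> /eqP nc; rewrite !mulmxA J_mul_tr (modn_small (ltn_ord c)).
    case: eqP => [e|_]; first by case: nc; apply: val_inj; rewrite /= e.
    by rewrite raddf0 !mul0mx.
  case: ifP => e; last first.
    by rewrite big1 // => c /eqP ec; apply: z; apply: contraFneq e => ce; rewrite -ec ce.
  rewrite (bigD1 (Ordinal bg)) //= big1 ?addr0 => [|c /andP[_ /z //]].
  rewrite !mulmxA J_mul_tr modn_mod eqxx mul1mx -J_mod -addn1 modnDml addn1 J_mod.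
  by rewrite /W -addn1 modnDml addn1.
case: ifP => _; last by rewrite !mul0mx.
by rewrite -mulmxA IH mulmxA addnS addSn.
Qed.

Lemma along_eq0 b w : (exists2 q, (q < size w)%N &
    nth x0 g ((b + q) %% size g)%N != nth x0 w q) -> along b w = 0.
Proof.
elim: w b => [|x w IH] b [q] //=.
case: q => [|q] ltq; first by rewrite addn0 /= => /negPf ->.
rewrite /= addnS -addSn => ne; rewrite IH ?mulmx0 ?if_same //.
by exists q.
Qed.

(** From any vertex b to the end of g the closing edge is crossed exactly once. Allowing all b makes
    the induction run; b = 0 gives g. *)
Lemma along_drop b : (b < size g)%N -> along b (drop b g) = C.
Proof.
move=> ltb; have [n] := ubnP (size g - b); elim: n b ltb => // n IH b ltb ltn.
rewrite (drop_nth x0 ltb) /= modn_small // eqxx /W.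
case: (ltngtP b.+1 (size g)) ltb => // [ltb _|eb _].
  by rewrite modn_small // mul1mx IH //; lia.
by rewrite eb drop_size modnn /= mulmx1.
Qed.

Lemma cyclic_graph_entry w (b : 'I_(size g)) (a : 'I_N) j :
  mxword cyclic_graph w (mxtens_index (b, a)) j =
  (along b w *m J (b + size w)) a j.
Proof.
rewrite -J_mxword mxE (bigD1 (mxtens_index (b, a))) //= big1 => [|k nk].
  by rewrite !mxE mxtens_indexK modn_small // !eqxx mul1r addr0.
rewrite [J _ _ _]mxE (modn_small (ltn_ord b)).
have [e1|ne] := eqVneq ((mxtens_unindex k).1 : nat) b; last by rewrite mul0r.
have [e2|ne] := eqVneq (mxtens_unindex k).2 a; last by rewrite mul0r.
case/eqP: nk; rewrite -(mxtens_unindexK k); congr mxtens_index.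
by rewrite [LHS]surjective_pairing e2 (ord_inj e1).
Qed.

Lemma cyclic_graphE w i j :
  mxword cyclic_graph w i j =
  (along (mxtens_unindex i).1 w *m J ((mxtens_unindex i).1 + size w))
    (mxtens_unindex i).2 j.
Proof.
by rewrite -cyclic_graph_entry -surjective_pairing mxtens_unindexK.
Qed.

Lemma cyclic_graph_neq0 w i j : mxword cyclic_graph w i j != 0 ->
  (mxtens_unindex j).1 = (((mxtens_unindex i).1 + size w) %% size g)%N :> nat /\
  forall q, (q < size w)%N ->
    nth x0 g (((mxtens_unindex i).1 + q) %% size g)%N = nth x0 w q.
Proof.
move=> nz; split; last first.
  move=> q ltq; apply/eqP; apply: contraNT nz => ne.
  by rewrite cyclic_graphE along_eq0 ?mul0mx ?mxE //; exists q.
apply/eqP; apply: contraNT nz => ne.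
rewrite cyclic_graphE mxE big1 // => a _.
by rewrite [J _ _ _]mxE (negPf ne) mulr0.
Qed.

Hypothesis gprim : primitive g.

(** A walk spelling g from another vertex than 0 would make g equal to a nontrivial rotation of
    itself. So only the block at vertex 0 survives, and it is C. *)
Lemma detl_cyclic_graph : detl (mxword cyclic_graph g) = detl C.
Proof.
suff -> : mxword cyclic_graph g = (J 0)^T *m (C *m J 0).
  by rewrite detl_mulC -mulmxA J_mul_tr eqxx mulmx1.
apply/matrixP => i j; rewrite -(mxtens_unindexK i).
case: (mxtens_unindex i) => b a.
have JE k : (J 0)^T (mxtens_index (b, a)) k = ((b == 0 :> nat)%N && (a == k))%:R.
  by rewrite !mxE mxtens_indexK mod0n.
rewrite [RHS]mxE; have [b0|nb] := eqVneq (b : nat) 0%N.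
  rewrite cyclic_graph_entry b0 add0n.
  have := along_drop g0; rewrite drop0 => ->.
  rewrite -(J_mod (size g)) modnn (bigD1 a) //= big1 => [|k nk].
    by rewrite JE b0 !eqxx mul1r addr0.
  by rewrite JE (eq_sym a) (negPf nk) andbF mul0r.
rewrite big1 => [|k _]; last by rewrite JE (negPf nb) mul0r.
apply/eqP; apply: contraTT nb => /cyclic_graph_neq0; rewrite mxtens_indexK.
move=> [_ H]; rewrite negbK.
apply/eqP/(primitive_rot_id gprim (ltn_ord _)).
apply: (@eq_from_nth _ x0); rewrite size_rot // => q ltq.
by rewrite -{1}(modn_small ltq) nth_rot_mod // H.
Qed.

Lemma detl_cyclic_graph1 w : primitive w -> (forall k, rot k g <> w) ->
  detl (mxword cyclic_graph w) = 1.
Proof.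
move=> pw H; apply: det_add1_acyclic => u.
have w0 : w != [::] by case/andP: pw.
pose B k := ((mxtens_unindex (u k)).1 : nat).
(* With |g| + |w| nonzero steps the walk spells enough copies of w to compare w^oo with the rotation
   of g^oo by [B 0] on |g| + |w| letters. *)
have [/existsP[k /eqP Ak]|] := boolP [exists k : 'I_(size g + size w),
    mxword cyclic_graph w (u k) (u k.+1) == 0].
  by exists k; rewrite !mxE Ak polyC0 mulr0.
rewrite negb_exists => /forallP nz; exfalso.
have step k : (k < size g + size w)%N -> B k.+1 = ((B k + size w) %% size g)%N /\
    forall q, (q < size w)%N -> nth x0 g ((B k + q) %% size g)%N = nth x0 w q.
  by move=> ltk; exact: (cyclic_graph_neq0 (nz (Ordinal ltk))).
have BE k : (k <= size g + size w)%N -> B k = ((B 0 + k * size w) %% size g)%N.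
  elim: k => [_|k IH ltk]; first by rewrite mul0n addn0 modn_small // ltn_ord.
  by rewrite (step k ltk).1 (IH (ltnW ltk)) modnDml mulSn -addnA (addnC (size w)).
have pr : primitive (rot (B 0) g) by apply: primitive_rot.
apply: (H (B 0)); apply: primitive_commute => //.
apply: (@same_periodic_extension _ x0) => // [|n].
  by case/andP: pr.
rewrite size_rot => ltn.
have sw : (0 < size w)%N by rewrite lt0n size_eq0.
rewrite nth_rot_mod //; last exact: ltn_ord.
have ltq : (n %/ size w < size g + size w)%N.
  exact: leq_ltn_trans (leq_div _ _) ltn.
have := (step _ ltq).2 (n %% size w)%N; rewrite ltn_mod sw => /(_ isT) <-.
by rewrite (BE _ (ltnW ltq)) modnDml -addnA -divn_eq.
Qed.

End CyclicGraph.

(** * Realizing prescribed values *)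

Lemma detl_mxword_rot (R : comNzRingType) (d n : nat) (Y : letter d -> 'M[R]_n) k w :
  detl (mxword Y (rot k w)) = detl (mxword Y w).
Proof.
rewrite -[in RHS](cat_take_drop k w) /rot !mxword_cat; exact: detl_mulC.
Qed.

Section Realization.
Context (R : comNzRingType) (d : nat) (i h : R).
Hypotheses (ii : i * i = -1) (h2 : h *+ 2 = 1).

Lemma exists_orth_block (g : word d) (T : nat) (P : {poly R}) :
  primitive g -> P`_0 = 1 ->
  exists n (M : 'I_d -> 'M[R]_n),
    eqtr T (detl (mxword (orth_letter M) g)) P /\
    forall w, primitive w -> ~~ sim g w ->
      detl (mxword (orth_letter M) w) = 1.
Proof.
move=> pg P0.
have g0 : (0 < size g)%N by case/andP: (pg); rewrite lt0n size_eq0.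
have x0 : letter d by case: (g) g0.
have other N (C : 'M[R]_N) w : primitive w -> ~~ sim g w ->
    detl (mxword (orth_letter (hyperbolic i h (cyclic_graph x0 g C))) w) = 1.
  move=> pw /simP ns; rewrite detl_hyperbolic //.
  have n1 k : rot k g <> w by move=> e; apply: ns; exists k; left.
  have n2 k : rot k g <> wordT w by move=> e; apply: ns; exists k; right.
  by rewrite !detl_cyclic_graph1 ?mulr1 //; exact: primitive_wordT.
have [/hasP[k _ /eqP ek]|/hasPn nk] :=
    boolP (has (fun k => rot k g == wordT g) (iota 0 (size g).+1)).
  have [Q [Q0 QQ]] := exists_sqrt T h2 P0.
  have [N [C eC]] := exists_detl T Q0.
  exists _, (hyperbolic i h (cyclic_graph x0 g C)); split; last exact: other.
  rewrite detl_hyperbolic // -ek detl_mxword_rot detl_cyclic_graph //.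
  by move=> t le_t; rewrite -QQ //; apply: (eqtrM eC eC).
have [N [C eC]] := exists_detl T P0.
exists _, (hyperbolic i h (cyclic_graph x0 g C)); split; last exact: other.
rewrite detl_hyperbolic // detl_cyclic_graph // detl_cyclic_graph1 ?mulr1 //.
  exact: primitive_wordT.
(* [nk] covers rotations by at most |g|; a larger index leaves g unchanged and is treated as 0. *)
move=> k e; have [le_k|gt_k] := leqP k (size g).
  by have := nk k; rewrite mem_iota /= add0n ltnS e eqxx => /(_ le_k).
by have := nk 0%N; rewrite mem_iota /= rot0 -e rot_oversize ?eqxx ?(ltnW gt_k) // => /(_ isT).
Qed.

Lemma mxword_block m n (M : 'I_d -> 'M[R]_m) (M' : 'I_d -> 'M[R]_n) w :
  mxword (orth_letter (fun k => block_mx (M k) 0 0 (M' k))) w =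
  block_mx (mxword (orth_letter M) w) 0 0 (mxword (orth_letter M') w).
Proof.
elim: w => [|x w IH] /=; first by rewrite -scalar_mx_block.
have -> : orth_letter (fun k => block_mx (M k) 0 0 (M' k)) x =
    block_mx (orth_letter M x) 0 0 (orth_letter M' x).
  by rewrite /orth_letter; case: x.2; rewrite // tr_block_mx !trmx0.
by rewrite IH mulmx_block !mul0mx !mulmx0 !addr0 !add0r.
Qed.

(** Direct sum of one block per class in [cs]: the block of c0 multiplies the value at every other
    class by 1. *)
Lemma exists_orth_rep (T : nat) (P : primclass d -> {poly R})
    (cs : seq (primclass d)) :
  uniq cs -> (forall c, (P c)`_0 = 1) ->
  exists n (M : 'I_d -> 'M[R]_n), (0 < n)%N /\ forall c,
    eqtr T (detl (mxword (orth_letter M) (val (repr c))))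
      (if c \in cs then P c else 1).
Proof.
move=> ucs P0; elim: cs ucs => [_|c0 cs IH /= /andP[c0cs ucs]].
  (* Size 1 rather than 0, since free relations are tested at n > 0 only. *)
  exists 1%N, (fun=> 0); split=> // c t _; rewrite in_nil.
  suff -> : mxword (orth_letter (fun=> 0)) (val (repr c)) = 0 :> 'M[R]_1.
    by rewrite /detl map_mx0 scaler0 addr0 det1.
  case: (repr c) => -[//|x w] _ /=; rewrite /orth_letter.
  by case: x.2; rewrite ?trmx0 mul0mx.
have [n [M [n0 eM]]] := IH ucs.
have [m [M' [eM1 eM2]]] := exists_orth_block T (valP (repr c0)) (P0 c0).
exists (m + n)%N, (fun k => block_mx (M' k) 0 0 (M k)).
split; first by rewrite addn_gt0 n0 orbT.
move=> c; rewrite mxword_block detl_block in_cons.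
have [->|nc] := eqVneq c c0.
  by have := eqtrM eM1 (eM c0); rewrite (negPf c0cs) mulr1.
rewrite eM2 ?mul1r; [exact: eM | exact: valP |].
apply: contra nc => s; rewrite eq_sym -(reprK c) -(reprK c0); apply/eqP.
by apply/eqmodP.
Qed.

Lemma exists_orth_rep_values (L : seq (sigma_idx d)) (y : sigma_idx d -> R) :
  exists n (M : 'I_d -> 'M[R]_n), (0 < n)%N /\ forall j, j \in L ->
    (detl (mxword (orth_letter M) (val (repr j.2))))`_(val j.1) = y j.
Proof.
pose T := \max_(j <- L) val j.1.
(* [insub t] fails exactly at t = 0, where the default 1 supplies the required constant term. *)
pose P (c : primclass d) : {poly R} :=
  \poly_(t < T.+1) oapp (fun t' : posnat => y (t', c)) 1 (insub t).
have P0 c : (P c)`_0 = 1 by rewrite coef_poly insubF.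
have [n [M [n0 eM]]] := exists_orth_rep T (undup_uniq [seq j.2 | j <- L]) P0.
exists n, M; split=> // j jL.
have le_t : (val j.1 <= T)%N by rewrite /T (big_rem _ jL) leq_maxl.
have jc : j.2 \in undup [seq j.2 | j <- L] by rewrite mem_undup; exact: map_f.
by rewrite eM // jc coef_poly ltnS le_t valK /= -surjective_pairing.
Qed.

End Realization.

(** * Evaluation of free relations at the realizing matrices *)

Section Faithful.
Context (F : fieldType) (d : nat).

Lemma malgUM (I : choiceType) (m1 m2 : {cmonom I}) :
  << m1 >> * << m2 >> = << mmul m1 m2 >> :> {malg F[{cmonom I}]}.
Proof. by rewrite malgM_def fgmulUU mulr1. Qed.

Lemma malgCU (I : choiceType) (a : F) (m : {cmonom I}) :
  << a *g m >> = a%:MP * << m >> :> {malg F[{cmonom I}]}.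
Proof. by rewrite malgM_def fgmulUU mulr1 mul1m. Qed.

Lemma pvarX (I : choiceType) (i : I) k :
  exists2 m : {cmonom I}, pvar F i ^+ k = << m >> & forall j, m j = ((i == j) * k)%N.
Proof.
elim: k => [|k [m e em]]; first by exists mone => [|j]; rewrite ?cm1 ?muln0.
exists (mmul (ucm i) m).
  by rewrite exprS e; exact: malgUM.
by move=> j; rewrite cmM em cmU mulnS.
Qed.

Lemma cmeval_pvar (I : choiceType) (m : {cmonom I}) :
  cmeval (@pvar F I) m = << m >>.
Proof.
have H (s : seq I) : uniq s -> exists2 m' : {cmonom I},
    \prod_(i <- s) pvar F i ^+ m i = << m' >> &
    forall j, m' j = (if j \in s then m j else 0)%N.
  elim: s => [_|i s IH /= /andP[nis /IH [m' e em]]].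
    by exists mone => [|j]; rewrite ?big_nil // cm1.
  have [m2 e2 em2] := pvarX i (m i); exists (mmul m2 m').
    by rewrite big_cons e e2; exact: malgUM.
  move=> j; rewrite cmM em em2 in_cons eq_sym.
  by have [->|_] := eqVneq j i; rewrite ?(negPf nis) ?mul1n ?addn0.
have [m' e em] := H _ (fset_uniq (finsupp m)).
rewrite /cmeval e; congr << _ >>; apply/eqP/cmP => j; rewrite em.
by case: ifP => // /negbT; rewrite -cmE_eq0 => /eqP.
Qed.

Lemma word_mx_eval (S : comNzRingType) n (phi : {rmorphism Rn F d n -> S})
    (M : 'I_d -> 'M[S]_n) :
  (forall k, map_mx phi (generic_mx F n k) = M k) ->
  forall w, map_mx phi (word_mx F n w) = mxword (orth_letter M) w.
Proof.
move=> eM w; elim: w => [|x w IH] /=.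
  by rewrite /word_mx big_nil map_mx1.
rewrite -IH -[x :: w]cat1s word_mx_cat map_mxM /word_mx big_seq1.
congr (_ *m _); rewrite /letter_mx /orth_letter; case: x.2; rewrite // -eM.
by rewrite map_trmx.
Qed.

Lemma free_relation_eq0 (f : Nsigma F d) :
  2%N \notin [pchar F] -> free_relation f -> f = 0.
Proof.
move=> ch2 ff; set S := gauss (Nsigma F d).
have two0 : (2%:R : F) != 0 by move: ch2; rewrite inE.
pose cR : {rmorphism F -> S} :=
  (@gaussC (Nsigma F d)) \o (@malgC {cmonom (sigma_idx d)} F).
have h2 : cR (2%:R^-1) *+ 2 = 1.
  by rewrite -(rmorphMn cR) -mulr_natl mulfV // (rmorph1 cR).
(* The finitely many generators that occur in f. *)
pose L : seq (sigma_idx d) :=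
  flatten [seq enum_fset (finsupp m)
          | m : {cmonom (sigma_idx d)} <- enum_fset (msupp f)].
have [n [M [n0 eM]]] := exists_orth_rep_values (gaussi_sqr _) h2 L
  (fun j : sigma_idx d => gaussC (pvar F j)).
pose v (ijk : Rn_idx d n) : S := M ijk.2 ijk.1.1 ijk.1.2.
pose phi : {rmorphism Rn F d n -> S} := mmap cR (cmeval v).
have phiM k : map_mx phi (generic_mx F n k) = M k.
  apply/matrixP => a b; rewrite !mxE; apply: etrans (mmapU _ _) _.
  apply: etrans (mul1r (v (a, b, k))).
  by congr (_ * _); exact: cmevalU.
have phi_gen i : i \in L -> phi (Psi_gen F n i) = gaussC (pvar F i).
  (* The cutoff t <= n in [Psi_gen] is also that of [coef_detl], so both cases agree. *)
  move=> iL; rewrite -eM // -(word_mx_eval phiM) coef_detl.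
  by rewrite /Psi_gen; case: ifP => _; rewrite ?rmorph0 // sigma_map.
apply: (@gaussC_inj (Nsigma F d)); rewrite rmorph0 -(rmorph0 phi) -(ff n n0).
rewrite /Psi mmapE rmorph_sum [in LHS](monalgE f) rmorph_sum.
rewrite big_seq [RHS]big_seq; apply: eq_bigr => m mf.
have phi_m : phi (cmeval (Psi_gen F n) m) = gaussC (<< m >> : Nsigma F d).
  rewrite -cmeval_pvar /cmeval !rmorph_prod big_seq [RHS]big_seq.
  apply: eq_bigr => j jm; rewrite !rmorphXn phi_gen //.
  by apply/flattenP; exists (enum_fset (finsupp m)) => //; exact: map_f.
rewrite malgCU (rmorphM phi) phi_m rmorphM; congr (_ * _); symmetry; exact: mmapC.
Qed.

End Faithful.

Theorem lemma6p5 (F : fieldType) (d : nat)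
  (hF : infinite_type F) (h2 : 2%N \notin [pchar F]) (hd : (0 < d)%N) :
  (forall p : nat, p \in [pchar F] ->
     forall f : Nsigma F d, free_relation f ->
       in_ideal (fun g : Nsigma F d =>
                   exists (t : posnat) (a : primword d),
                     g = sigma_sym F t a ^+ p) f) /\
  ([pchar F] =i pred0 ->
     forall f : Nsigma F d, free_relation f <-> f = 0).
Proof.
split=> [p _ f ff|_ f].
  (* As f = 0, the empty combination shows membership in the ideal. *)
  by exists [::]; rewrite big_nil (free_relation_eq0 h2 ff).
split=> [|-> n _]; first exact: free_relation_eq0.
exact: raddf0.
Qed.
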